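(* For every integer $k \geq 1$, the map $\Phi_k: \{0,1,\ldots,2^k-1\} \to \{0,1,\ldots,2^k-1\}$ defined by $\Phi_k(n) = \sum_{i=0}^{k-1} x_i(n)\, 2^i$ is a (directed) graph isomorphism from the binary Collatz graph $C(k)$ to the binary De Bruijn graph $B(2,k)$.
   Context: Let $T:\mathbb{Z}\to\mathbb{Z}$ be the $3n+1$ function: $T(n) = (3n+1)/2$ if $n$ is odd and $T(n) = n/2$ if $n$ is even; $T^0(n)=n$, $T^{j+1}(n)=T(T^j(n))$. For an integer $n$ and $i \geq 0$, let $x_i(n) \in \{0,1\}$ be defined by $x_i(n) \equiv T^i(n) \pmod 2$. (For $i<k$, $x_i(n)$ depends only on $n \bmod 2^k$.) All graphs are directed. For a modulus $m$, the modular Collatz graph with modulus $m$ has vertex set $\{0,1,\ldots,m-1\}$ and a directed edge from $a$ to $b$ if and only if there exist integers $a_1 \equiv a \pmod m$ and $b_1 \equiv b \pmod m$ with $T(a_1)=b_1$. The binary Collatz graph $C(k)$ is the modular Collatz graph with modulus $2^k$. The binary De Bruijn graph $B(2,k)$ has vertex set $\{0,1,\ldots,2^k-1\}$, where a number $\sum_{i=0}^{k-1} b_i 2^i$ ($b_i\in\{0,1\}$) is identified with the word $b_0b_1\cdots b_{k-1}$, and there is an edge from the word $a_0a_1\cdots a_{k-1}$ to the word $b_0b_1\cdots b_{k-1}$ if and only if $a_{i+1}=b_i$ for $i=0,\ldots,k-2$. *)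

(* Defs.v *)
From mathcomp Require Import all_boot all_order all_algebra.

Set Implicit Arguments.
Unset Strict Implicit.
Unset Printing Implicit Defensive.

Import GRing.Theory.

(* Both quotients are exact, so the rounding convention of %/ is irrelevant. *)
Definition collatz (n : int) : int :=
  if (n %% 2)%Z == 1%R then ((3 * n + 1)%R %/ 2)%Z else (n %/ 2)%Z.

(* x_i(n): (_ %% 2)%Z is 0 or 1 also for negative arguments. *)
Definition parity_digit (i : nat) (n : int) : nat :=
  `|(iter i collatz n %% 2)%Z|%N.

Definition modular_collatz_edge (m : nat) (a b : 'I_m) : Prop :=
  exists a1 b1 : int,
    [/\ (a1 = a%:Z %[mod m%:Z])%Z, (b1 = b%:Z %[mod m%:Z])%Z
      & collatz a1 = b1].

Definition binary_collatz_edge (k : nat) : 'I_(2 ^ k) -> 'I_(2 ^ k) -> Prop :=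
  @modular_collatz_edge (2 ^ k).

(* The least significant digit is the first letter of the word. *)
Definition word_value (k : nat) (w : k.-tuple bool) : nat :=
  \sum_(i < k) tnth w i * 2 ^ i.

Definition de_bruijn_edge (k : nat) (a b : 'I_(2 ^ k)) : Prop :=
  exists u v : k.-tuple bool,
    [/\ word_value u = a, word_value v = b
      & forall i : nat, i.+1 < k -> nth false u i.+1 = nth false v i].

Lemma parity_digit_le1 (i : nat) (n : int) : parity_digit i n <= 1.
Proof.
rewrite /parity_digit.
have := modz_ge0 (iter i collatz n) (isT : 2%Z != 0%R).
have := ltz_pmod (iter i collatz n) (isT : (0 < 2 :> int)%R).
by case: (_ %% _)%Z.
Qed.

Lemma parity_sum_lt (k : nat) (n : int) :
  \sum_(i < k) parity_digit i n * 2 ^ i < 2 ^ k.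
Proof.
elim: k => [|k IHk]; first by rewrite big_ord0.
rewrite big_ord_recr /= expnS mul2n -addnn -addSn leq_add //.
by rewrite -[X in _ <= X]mul1n leq_mul2r parity_digit_le1 orbT.
Qed.

Definition Phi (k : nat) (n : 'I_(2 ^ k)) : 'I_(2 ^ k) :=
  Ordinal (parity_sum_lt k n%:Z).

(* A directed graph is given by its edge relation; loops are allowed. *)
Definition digraph_isomorphism (V W : Type) (E : V -> V -> Prop)
    (E' : W -> W -> Prop) (f : V -> W) : Prop :=
  bijective f /\ forall u v : V, E u v <-> E' (f u) (f v).

(* Main.v *)
(* The digits of [n] are its parity followed by the digits of [T n].  For [m] a
   power of 2, the residue of [n] modulo [2m] is determined by its parity and
   the residue of [T n] modulo [m], for odd [n] because 3 is invertible modulo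
   [2m]; hence by induction the first [k] digits determine, and are determined
   by, the residue of [n] modulo [2 ^ k].  The edge relations, between [a] and
   [b] and between [Phi a] and [Phi b], then both amount to [T a = b] modulo
   [2 ^ (k - 1)]: replacing [a] by [a + 2 ^ k * e] moves [T a] by
   [2 ^ (k - 1) * e] or [3 * 2 ^ (k - 1) * e], which is enough to reach any
   residue modulo [2 ^ k] above a given one modulo [2 ^ (k - 1)]. *)
Require Import Defs.
From mathcomp Require Import all_boot all_order all_algebra.
From mathcomp Require Import zify ring.

Import GRing.Theory.

(** Uniqueness of binary expansions: parity gives the lowest bit, and induction applies to the half
    of what remains. *)
Lemma binary_sum_inj (k : nat) (f g : nat -> bool) :
  \sum_(i < k) f i * 2 ^ i = \sum_(i < k) g i * 2 ^ i ->
  forall i, i < k -> f i = g i.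
Proof.
elim: k f g => [|k IHk] f g //.
have shift (h : nat -> bool) :
    \sum_(i < k.+1) h i * 2 ^ i = h 0 + 2 * \sum_(i < k) h i.+1 * 2 ^ i.
  rewrite big_ord_recl muln1 big_distrr /=; congr (_ + _).
  by apply: eq_bigr => i _; rewrite expnS mulnCA.
rewrite !shift => eq_sums.
have eq0 : f 0 = g 0 by case: (f 0) (g 0) eq_sums => [] []; lia.
case=> [|i] lt_ik //.
apply: (IHk (fun i => f i.+1) (fun i => g i.+1)) => //.
by move: eq_sums; rewrite eq0; lia.
Qed.

Definition parity_bit (i : nat) (n : int) : bool :=
  (iter i collatz n %% 2)%Z == 1%R.

Lemma parity_digitE (i : nat) (n : int) :
  parity_digit i n = parity_bit i n.
Proof. by rewrite /parity_digit /parity_bit; case: eqP; lia. Qed.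

Lemma parity_bitS (i : nat) (n : int) :
  parity_bit i.+1 n = parity_bit i (collatz n).
Proof. by rewrite /parity_bit iterSr. Qed.

Lemma parity_sumE (k : nat) (n : int) :
  \sum_(i < k) parity_digit i n * 2 ^ i = \sum_(i < k) parity_bit i n * 2 ^ i.
Proof. by apply: eq_bigr => i _; rewrite parity_digitE. Qed.

(** Identifies the words witnessing a De Bruijn edge between values of [Phi] as parity words. *)
Lemma word_value_parity (k : nat) (w : k.-tuple bool) (n : int) :
  word_value w = \sum_(i < k) parity_digit i n * 2 ^ i <->
  forall i, i < k -> nth false w i = parity_bit i n.
Proof.
have -> : word_value w = \sum_(i < k) nth false w i * 2 ^ i.
  by apply: eq_bigr => i _; rewrite (tnth_nth false).
rewrite parity_sumE; split; first exact: binary_sum_inj.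
by move=> eq_bits; apply: eq_bigr => i _; rewrite eq_bits.
Qed.

Local Open Scope ring_scope.

Lemma eqz_modP (m a b : int) :
  (a = b %[mod m])%Z <-> exists e : int, b = a + m * e.
Proof.
split=> [/esym/eqP|[e ->]]; last by rewrite addrC mulrC modzMDl.
by rewrite eqz_mod_dvd => /dvdzP[e eq_e]; exists e; rewrite mulrC -eq_e; ring.
Qed.

Lemma exp2SzE (j : nat) : (2 ^ j.+1)%N%:Z = 2 * (2 ^ j)%N%:Z.
Proof. by rewrite expnS PoszM. Qed.

(** An even shift keeps the parity, so both arguments take the same branch. *)
Lemma collatz_shift (m a e : int) :
  collatz (a + 2 * m * e) =
  collatz a + m * e * (if (a %% 2)%Z == 1 then 3 else 1).
Proof.
have -> : 2 * m * e = 2 * (m * e) by ring.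
move: (m * e) => t; rewrite /collatz.
have -> : ((a + 2 * t) %% 2)%Z = (a %% 2)%Z by lia.
by case: ifP; lia.
Qed.

Lemma collatz_eq_mod (j : nat) (a b : int) :
  (a = b %[mod (2 ^ j.+1)%N])%Z <->
  (a = b %[mod 2])%Z /\ (collatz a = collatz b %[mod (2 ^ j)%N])%Z.
Proof.
rewrite exp2SzE; split=> [/eqz_modP[e ->]|[eq_par /eqz_modP[e eq_e]]].
  split; first by apply/eqz_modP; exists ((2 ^ j)%N%:Z * e); ring.
  by apply/eqz_modP; rewrite collatz_shift; eexists; rewrite -mulrA.
have cop : coprimez (2 * (2 ^ j)%N%:Z)%R 3.
  by rewrite -exp2SzE coprimezE coprimeXl.
apply/esym/eqP; rewrite eqz_mod_dvd.
move: eq_e; rewrite /collatz -eq_par; case: ifP => par_a eq_e.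
  (* For odd [a], [e] only witnesses divisibility of [3 * (b - a)]; coprimality cancels the 3. *)
  rewrite -(Gauss_dvdzr _ cop); apply/dvdzP; exists e; lia.
by apply/dvdzP; exists e; lia.
Qed.

Lemma parity_bits_eq_mod (k : nat) (a b : int) :
  (forall i, (i < k)%N -> parity_bit i a = parity_bit i b) <->
  (a = b %[mod (2 ^ k)%N])%Z.
Proof.
elim: k a b => [|k IHk] a b; first by rewrite expn0 !modz1; split.
rewrite collatz_eq_mod -IHk; split=> [eq_bits|[eq_par eq_bits] [|i] lt_ik].
- split=> [|i lt_ik]; last by rewrite -!parity_bitS eq_bits.
  by have := eq_bits 0%N isT; rewrite /parity_bit /=; lia.
- by rewrite /parity_bit /= eq_par.
by rewrite !parity_bitS eq_bits.
Qed.

Lemma Phi_bij (k : nat) : bijective (@Phi k).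
Proof.
apply: injF_bij => a b /(congr1 val) /=; rewrite !parity_sumE.
move=> /binary_sum_inj/parity_bits_eq_mod; rewrite !modz_nat.
by rewrite !modn_small // => -[] /val_inj.
Qed.

Lemma collatz_edgeE (j : nat) (a b : 'I_(2 ^ j.+1)) :
  binary_collatz_edge a b <-> (collatz a = b %[mod (2 ^ j)%N])%Z.
Proof.
rewrite /binary_collatz_edge /modular_collatz_edge.
split=> [[a1 [b1 [/collatz_eq_mod[_ eq_a] eq_b eq_b1]]]|/eqz_modP[e eq_b]].
  rewrite -eq_a eq_b1; move: eq_b; rewrite exp2SzE => /eqz_modP[e ->].
  by apply/eqz_modP; exists (2 * e); ring.
(* Here [e] is the quotient of [b - collatz a] by [2 ^ j]. *)
exists (a%:Z + (2 ^ j.+1)%N%:Z * e); eexists; split; last by [].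
  by apply/esym/eqz_modP; exists e.
rewrite exp2SzE collatz_shift eq_b; apply/esym/eqz_modP.
(* For odd [a] the tripled shift overshoots [b] by [2 * 2 ^ j * e]; for even [a] it lands on [b]
   exactly. *)
by case: ifP => _; [exists e | exists 0]; ring.
Qed.

(** Bit [i.+1] of [a] is bit [i] of [collatz a], so the overlap of the words compares the first [j]
    bits of [collatz a] and [b]. *)
Lemma de_bruijn_edge_Phi (j : nat) (a b : 'I_(2 ^ j.+1)) :
  de_bruijn_edge (Phi a) (Phi b) <-> (collatz a = b %[mod (2 ^ j)%N])%Z.
Proof.
rewrite -parity_bits_eq_mod; split=> [|eq_bits].
  move=> [u [v [/word_value_parity eq_u /word_value_parity eq_v eq_uv]]] i lt_ij.
  by rewrite -parity_bitS -eq_u // -eq_v ?eq_uv // ltnW.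
pose word (n : int) := [tuple parity_bit i n | i < j.+1].
have nth_word n i : (i < j.+1)%N -> nth false (word n) i = parity_bit i n.
  by move=> lt_ij; rewrite -[i]/(val (Ordinal lt_ij)) -tnth_nth tnth_mktuple.
exists (word a), (word b); split.
- by apply/word_value_parity => i; exact: nth_word.
- by apply/word_value_parity => i; exact: nth_word.
by move=> i lt_ij; rewrite !nth_word ?parity_bitS ?eq_bits // ltnW.
Qed.

Local Close Scope ring_scope.

Theorem theorem1 (k : nat) (hk : 1 <= k) :
  digraph_isomorphism (@binary_collatz_edge k) (@de_bruijn_edge k) (@Phi k).
Proof.
split; first exact: Phi_bij.
by case: k hk => // j _ a b; rewrite collatz_edgeE de_bruijn_edge_Phi.
Qed.
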